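(* Let $V=V_1\uplus\cdots\uplus V_k$ be a finite ground set partitioned into disjoint nonempty sets, let $b_1,\dots,b_k$ be integers with $1\le b_i\le n_i:=|V_i|$, and let $f:2^V\to\mathbb{R}_{\ge 0}$ be monotone with $f(\emptyset)=0$. Let $\gamma$ and $\alpha$ be the partition matroid diminishing-return ratio and partition matroid curvature of $f$ (defined in the context), and let $\gamma',\alpha'$ be numbers with $0<\gamma'\le\gamma$ and $\alpha\le\alpha'\le 1$. Let $S_b$ be the output of the algorithm \textsc{Prob} (described in the context) on this input, and let $S^*$ be an optimal solution, i.e. $f(S^* )=\max\{f(S): S\subseteq V,\ |S\cap V_i|\le b_i\ \forall i\in[k]\}$. Then $$f(S^* )\le\left[\Big(\frac{1}{\gamma'}+\alpha'-1\Big)\Big(1-\frac{1}{\bar n+2}\Big)+1\right]\mathbb{E}[f(S_b)],$$ where $\bar n=\max_{i\in[k]} n_i$, and \textsc{Prob} uses $O\big(\sum_{i\in[k]} n_i b_i\big)$ queries (evaluations) of $f$.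
   Context: Notation: for a set $S$ and $e\notin S$, $\Delta_e f(S):=f(S\cup\{e\})-f(S)$; $b=\sum_{i\in[k]} b_i$. The partition matroid (PM) diminishing-return ratio $\gamma$ is the maximum value in $[0,1]$ such that $\Delta_e f(T)\le \frac{1}{\gamma}\Delta_e f(S)$ for all $S\subseteq T\subseteq V$ with $|(T\setminus S)\cap V_i|\le b_i$ for all $i\in[k]$, and all $e\in V\setminus T$. The PM curvature $\alpha$ is the minimum value in $[0,1]$ such that $\Delta_e f(T)\ge(1-\alpha)\Delta_e f(S)$ for all such $S,T,e$. Algorithm \textsc{Prob} (input: the partition, $b_1,\dots,b_k$, $f$, $\gamma'$, $\alpha'$): set $I=[k]$, $S_0=\emptyset$, $t=0$. While $I\ne\emptyset$: for each $i\in I$ (in turn): let $a=\big\lceil \frac{|V_i\setminus S_t|+1}{1-\gamma'(1-\alpha')}\big\rceil-1$; choose $e_t\in V_i\setminus S_t$ at random, each $e$ with probability $\frac{(\Delta_e f(S_t))^a}{\sum_{u\in V_i\setminus S_t}(\Delta_u f(S_t))^a}$; set $S_{t+1}=S_t\cup\{e_t\}$, $t=t+1$; if $|S_t\cap V_i|\ge b_i$ remove $i$ from $I$. Return $S_b$.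
   Formalization: The sampling rule is undefined when γ'(1−α')=1 (division by zero in a) or when all marginals Δ_e f(S_t) on V_i∖S_t vanish (0/0); there e_t is drawn from an arbitrary distribution on the elements of V_i∖S_t with the largest marginal. *)

(* Defs.v *)
From HB Require Import structures.
From mathcomp Require Import all_boot all_order all_algebra.
From mathcomp Require Import reals.

Set Implicit Arguments.
Unset Strict Implicit.
Unset Printing Implicit Defensive.

Import Order.TTheory GRing.Theory Num.Theory.
Local Open Scope ring_scope.

Definition marginal (R : realType) (V : finType) (f : {set V} -> R)
    (e : V) (S : {set V}) : R :=
  f (e |: S) - f S.

Definition is_partition (V : finType) (k : nat) (Vp : 'I_k -> {set V}) : Prop :=
  [/\ \bigcup_(i < k) Vp i = [set: V],
      (forall i j : 'I_k, i != j -> [disjoint Vp i & Vp j])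
    & forall i : 'I_k, Vp i != set0].

Definition monotone (R : realType) (V : finType) (f : {set V} -> R) : Prop :=
  forall S T : {set V}, S \subset T -> f S <= f T.

Definition pm_pair (V : finType) (k : nat) (Vp : 'I_k -> {set V})
    (b : 'I_k -> nat) (S T : {set V}) : Prop :=
  S \subset T /\ forall i : 'I_k, (#|(T :\: S) :&: Vp i| <= b i)%N.

(* The premise [0 < g] renders 1/0 = +oo: the value g = 0 is always admissible. *)
Definition pm_ratio_admissible (R : realType) (V : finType) (k : nat)
    (Vp : 'I_k -> {set V}) (b : 'I_k -> nat) (f : {set V} -> R) (g : R) : Prop :=
  0 <= g <= 1 /\
  (0 < g -> forall (S T : {set V}) (e : V),
     pm_pair Vp b S T -> e \notin T ->
     marginal f e T <= g^-1 * marginal f e S).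

Definition is_pm_ratio (R : realType) (V : finType) (k : nat)
    (Vp : 'I_k -> {set V}) (b : 'I_k -> nat) (f : {set V} -> R) (g : R) : Prop :=
  pm_ratio_admissible Vp b f g /\
  forall h : R, pm_ratio_admissible Vp b f h -> h <= g.

Definition pm_curvature_admissible (R : realType) (V : finType) (k : nat)
    (Vp : 'I_k -> {set V}) (b : 'I_k -> nat) (f : {set V} -> R) (a : R) : Prop :=
  0 <= a <= 1 /\
  forall (S T : {set V}) (e : V),
    pm_pair Vp b S T -> e \notin T ->
    (1 - a) * marginal f e S <= marginal f e T.

Definition is_pm_curvature (R : realType) (V : finType) (k : nat)
    (Vp : 'I_k -> {set V}) (b : 'I_k -> nat) (f : {set V} -> R) (a : R) : Prop :=
  pm_curvature_admissible Vp b f a /\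
  forall h : R, pm_curvature_admissible Vp b f h -> a <= h.

Definition feasible (V : finType) (k : nat) (Vp : 'I_k -> {set V})
    (b : 'I_k -> nat) (S : {set V}) : Prop :=
  forall i : 'I_k, (#|S :&: Vp i| <= b i)%N.

Definition is_optimal (R : realType) (V : finType) (k : nat)
    (Vp : 'I_k -> {set V}) (b : 'I_k -> nat) (f : {set V} -> R)
    (S : {set V}) : Prop :=
  feasible Vp b S /\ forall T : {set V}, feasible Vp b T -> f T <= f S.

(* Randomized programs that access a set function only through an oracle:
   [Query S c] asks for the value at S and continues with the answer;
   [Sample p c] draws v with probability [p v] and continues with v. *)
Inductive prog (R : realType) (V : finType) (A : Type) : Type :=
| Ret of A
| Query of {set V} & (R -> prog R V A)
| Sample of (V -> R) & (V -> prog R V A).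

Arguments Ret {R V A} _.
Arguments Query {R V A} _ _.
Arguments Sample {R V A} _ _.

Fixpoint bind (R : realType) (V : finType) (A B : Type)
    (m : prog R V A) (c : A -> prog R V B) : prog R V B :=
  match m with
  | Ret x => c x
  | Query Q m' => Query Q (fun y => bind (m' y) c)
  | Sample p m' => Sample p (fun v => bind (m' v) c)
  end.

Fixpoint prob_output (R : realType) (V : finType) (A : eqType)
    (f : {set V} -> R) (m : prog R V A) (x : A) : R :=
  match m with
  | Ret y => (y == x)%:R
  | Query Q m' => prob_output f (m' (f Q)) x
  | Sample p m' => \sum_(v : V) p v * prob_output f (m' v) x
  end.

Definition expected_value (R : realType) (V : finType) (f : {set V} -> R)
    (m : prog R V {set V}) : R :=
  \sum_(S : {set V}) prob_output f m S * f S.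

(* Worst case over the runs of nonzero probability. *)
Fixpoint num_queries (R : realType) (V : finType) (A : Type)
    (f : {set V} -> R) (m : prog R V A) : nat :=
  match m with
  | Ret _ => 0%N
  | Query Q m' => (num_queries f (m' (f Q))).+1
  | Sample p m' => (\max_(v : V | p v != 0%R) num_queries f (m' v))%N
  end.

Definition exponent (R : realType) (g a : R) (m : nat) : int :=
  Num.ceil ((m%:R + 1) / (1 - g * (1 - a))) - 1.

(* The sampling formula is undefined when g (1 - a) = 1 (infinite exponent) and
   when every marginal vanishes (0/0).  Then the choice is made by an arbitrary
   rule [r], which is only required to be a probability distribution on the
   elements of largest marginal; in the 0/0 case these are all the candidates. *)
Definition max_rule (R : realType) (V : finType)
    (r : {set V} -> (V -> R) -> V -> R) : Prop :=
  forall (A : {set V}) (w : V -> R), A != set0 ->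
    [/\ forall e : V, 0 <= r A w e,
        \sum_(e : V) r A w e = 1
      & forall e : V, r A w e != 0 ->
          e \in A /\ forall u : V, u \in A -> w u <= w e].

Definition choice_prob (R : realType) (V : finType) (g a : R)
    (r : {set V} -> (V -> R) -> V -> R) (A : {set V}) (w : V -> R) (e : V) : R :=
  let m := exponent g a #|A| in
  let z := \sum_(u in A) w u ^ m in
  if (g * (1 - a) == 1) || (z == 0) then r A w e
  else if e \in A then w e ^ m / z else 0.

Fixpoint query_marginals (R : realType) (V : finType) (S : {set V}) (fS : R)
    (s : seq V) (w : V -> R) : prog R V (V -> R) :=
  if s is u :: s' then
    Query (u |: S) (fun y =>
      query_marginals S fS s' (fun v => if v == u then y - fS else w v))
  else Ret w.

Definition add_element (R : realType) (V : finType) (g a : R)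
    (r : {set V} -> (V -> R) -> V -> R) (Vi S : {set V}) : prog R V {set V} :=
  Query S (fun fS =>
    bind (query_marginals S fS (enum (Vi :\: S)) (fun _ => 0)) (fun w =>
      Sample (choice_prob g a r (Vi :\: S) w) (fun e => Ret (e |: S)))).

Fixpoint for_loop (R : realType) (V : finType) (k : nat) (Vp : 'I_k -> {set V})
    (b : 'I_k -> nat) (g a : R) (r : {set V} -> (V -> R) -> V -> R)
    (s : seq 'I_k) (I : {set 'I_k}) (S : {set V})
    : prog R V ({set 'I_k} * {set V}) :=
  if s is i :: s' then
    bind (add_element g a r (Vp i) S) (fun S' =>
      for_loop Vp b g a r s'
        (if (b i <= #|S' :&: Vp i|)%N then I :\ i else I) S')
  else Ret (I, S).

Fixpoint while_loop (R : realType) (V : finType) (k : nat)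
    (Vp : 'I_k -> {set V}) (b : 'I_k -> nat) (g a : R)
    (r : {set V} -> (V -> R) -> V -> R) (fuel : nat)
    (I : {set 'I_k}) (S : {set V}) : prog R V {set V} :=
  if I == set0 then Ret S
  else if fuel is fuel'.+1 then
    bind (for_loop Vp b g a r (enum I) I S) (fun IS =>
      while_loop Vp b g a r fuel' IS.1 IS.2)
  else Ret S.

(* Each pass of the while loop adds one element of V_i for every i in I, so
   the loop ends after max_i b_i passes and the fuel is never exhausted. *)
Definition Prob (R : realType) (V : finType) (k : nat) (Vp : 'I_k -> {set V})
    (b : 'I_k -> nat) (g a : R) (r : {set V} -> (V -> R) -> V -> R)
    : prog R V {set V} :=
  while_loop Vp b g a r (\sum_(i < k) b i)%N [set: 'I_k] set0.

(* Main.v *)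
(** Let [S] be the current set of the algorithm and [O] the part of the optimal
    solution not yet exchanged, with [#|O :&: Vp i| + #|S :&: Vp i| <= b i].
    When [e] is added to [S] in part [i], drop [e] from [O] if it is there, and
    otherwise drop the element [o] of [O :&: Vp i] with the largest marginal.
    Since [S] and [S :|: O :\ o] form an admissible pair, [f (S :|: O)]
    decreases by at most [g^-1 * w o - (1 - a) * w e], where [w] denotes the
    marginals at [S].  For the exponent [d] of the algorithm, the inequality
    [(d + 1) w^d x <= d w^(d+1) + x^(d+1)] bounds the expectation of this loss
    by [K] times the expected gain of [f S], with
    [K = (g^-1 + a - 1) (1 - 1/(n + 2))].  So [f (S :|: O) + K * f S] does not
    decrease in expectation; it starts at [f Sstar] and ends at
    [(K + 1) * f S], because [O] is empty when every part is full. *)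

Require Import Defs.
From HB Require Import structures.
From mathcomp Require Import all_boot all_order all_algebra.
From mathcomp Require Import reals.
From mathcomp Require Import ring lra zify.

Import Order.TTheory GRing.Theory Num.Theory.
Local Open Scope ring_scope.

Set Implicit Arguments.
Unset Strict Implicit.
Unset Printing Implicit Defensive.

(** * Power inequality and the integer exponent *)

(** Weighted AM-GM. The induction step adds the hypothesis times [x] to
    [(a + 1) * w^a * (w - x)^2 >= 0]. *)
Lemma young_pow (R : realType) (a : nat) (w x : R) : 0 <= w -> 0 <= x ->
  a.+1%:R * (w ^+ a * x) <= a%:R * w ^+ a.+1 + x ^+ a.+1.
Proof.
move=> w0 x0; elim: a => [|a IH]; first by
  rewrite !expr0 !expr1 !mul1r mul0r add0r.
have := ler_wpM2r x0 IH; set P := w ^+ a.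
have P0 : 0 <= P by rewrite exprn_ge0.
have := mulr_ge0 (ler0n R a.+1) (mulr_ge0 P0 (sqr_ge0 (w - x))).
rewrite !exprS -/P -!natr1; set X := x ^+ a; set n := a%:R.
nra.
Qed.

(** With [y] the quotient under the ceiling, [d = ceil y - 1] satisfies [d < y <= d + 1]; clearing
    the denominator gives the last two bounds. As [y >= m + 1], the ceiling is positive, so the
    exponent is a natural number. *)
Lemma exponentP (R : realType) (g a : R) (m : nat) :
  0 <= g * (1 - a) < 1 ->
  exists d : nat, [/\ (m <= d)%N, exponent g a m = d%:Z,
    m%:R + 1 <= (1 - g * (1 - a)) * d.+1%:R
    & (1 - g * (1 - a)) * d%:R <= m%:R + 1].
Proof.
rewrite /exponent; set c := g * (1 - a) => /andP[c0 c1].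
have c1' : 0 < 1 - c by rewrite subr_gt0.
set y := _ / _; have yE : y * (1 - c) = m%:R + 1 by rewrite divfK // gt_eqF.
have ym : m%:R + 1 <= y.
  rewrite /y ler_pdivlMr // ler_piMr ?addr_ge0 // lerBlDr lerDl //.
have := @ceil_itv _ y; rewrite ?num_real //.
case E : (Num.ceil y) => [[|d]|d] /andP[lo hi].
- by move: hi; rewrite mulr0z => hi; have := ler0n R m; lra.
- have hE : (Posz d.+1)%:~R = d%:R + 1 :> R by rewrite -pmulrn natr1.
  rewrite intrB hE in lo; rewrite hE in hi.
  exists d; split=> //.
  + by rewrite -(ler_nat R); lra.
  + by rewrite -addn1 PoszD addrK.
  + by rewrite -natr1 -yE mulrC ler_pM2l.
  + by rewrite -yE mulrC ler_pM2r//; lra.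
- move: hi; rewrite NegzE mulrNz -pmulrn => hi.
  by have := ler0n R m; have := ler0n R d.+1; lra.
Qed.

(** * The sampling distribution *)

Lemma choice_prob_dist (R : realType) (V : finType) (g a : R)
    (r : {set V} -> (V -> R) -> V -> R) (A : {set V}) (w : V -> R) :
  0 <= g * (1 - a) <= 1 -> max_rule r -> A != set0 ->
  (forall e, e \in A -> 0 <= w e) ->
  [/\ forall e, 0 <= choice_prob g a r A w e,
      \sum_e choice_prob g a r A w e = 1
    & forall e, choice_prob g a r A w e != 0 -> e \in A].
Proof.
move=> c01 hr A0 w0; have [r0 r1 rA] := hr A w A0.
rewrite /choice_prob /=.
case: (boolP ((g * (1 - a) == 1) || _)) => [_|].
  by split=> // e /rA[].
rewrite negb_or => /andP[c1 z0].
have c01' : 0 <= g * (1 - a) < 1.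
  by case/andP: c01 => c0 c1'; rewrite c0 lt_neqAle c1.
have [d [_ dE _ _]] := exponentP #|A| c01'; rewrite dE in z0 *.
have pos e : e \in A -> 0 <= w e ^ d%:Z.
  by move=> /w0 ?; rewrite -exprnP exprn_ge0.
split=> [e||e].
- by case: ifP => // eA; rewrite divr_ge0 ?pos ?sumr_ge0.
- by rewrite -big_mkcond /= -mulr_suml mulfV.
- by case: ifP => //; rewrite eqxx.
Qed.

(** The bound on the expected loss, multiplied through by [g]; [B] is the part of the optimum not
    yet exchanged. Any [n] above [#|A|] is allowed, so that one constant serves all parts and all
    steps. *)
Lemma choice_prob_exchange (R : realType) (V : finType) (g a : R)
    (r : {set V} -> (V -> R) -> V -> R) (A B : {set V}) (w : V -> R)
    (o : V) (n : nat) :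
  0 <= g * (1 - a) <= 1 -> max_rule r ->
  (forall e, e \in A -> 0 <= w e) ->
  o \in A -> o \in B -> (forall e, e \in A -> e \in B -> w e <= w o) ->
  (#|A| <= n)%N ->
  \sum_(e in A | e \notin B)
     choice_prob g a r A w e * (w o - g * (1 - a) * w e)
  <= (1 - g * (1 - a)) * (1 - (n%:R + 2)^-1)
       * \sum_(e in A) choice_prob g a r A w e * w e.
Proof.
move=> c01 hr w0 oA oB wB An.
have A0 : A != set0 by apply/set0Pn; exists o.
have [p0 p1 pA] := choice_prob_dist c01 hr A0 w0.
have [r0 r1 rA] := hr A w A0.
set p := choice_prob g a r A w in p0 p1 pA *; set c := g * (1 - a) in c01 *.
have /andP[c0 c1] := c01.
have n2 : 0 < n%:R + 2 :> R by rewrite ltr_wpDl.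
have n2i : 0 <= 1 - (n%:R + 2)^-1 :> R.
  by rewrite subr_ge0 invf_le1 // -lerBlDr (le_trans _ (ler0n _ n)) //; lra.
have pw0 e : e \in A -> 0 <= p e * w e by move=> eA; rewrite mulr_ge0 ?p0 ?w0.
have RHS0 : 0 <= (1 - c) * (1 - (n%:R + 2)^-1) * \sum_(e in A) p e * w e.
  by rewrite mulr_ge0 ?sumr_ge0 // mulr_ge0 // subr_ge0.
(* For [c = 1] the rule [r] only draws elements of maximal weight, so no term on the left is
   positive. *)
have [cE|cN1] := eqVneq c 1.
  apply: le_trans RHS0; apply: sumr_le0 => e /andP[eA eB].
  have [->|pe] := eqVneq (p e) 0; first by rewrite mul0r.
  rewrite mulr_ge0_le0 // cE mul1r subr_le0.
  move: pe; rewrite /p /choice_prob -/c cE eqxx /=.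
  by move=> /rA[_]; apply.
have c01' : 0 <= c < 1 by rewrite c0 lt_neqAle cN1.
have c1' : 0 < 1 - c by rewrite subr_gt0; case/andP: c01'.
have [d [md dE lo hi]] := exponentP #|A| c01'; rewrite -/c in lo hi.
have m0 : (0 < #|A|)%N by rewrite card_gt0.
have d0 : (0 < d)%N by apply: leq_trans md.
set z := \sum_(u in A) w u ^+ d.
have zE : \sum_(u in A) w u ^ (exponent g a #|A|) = z by rewrite dE.
have [z0|zN0] := eqVneq z 0.
  have wz e : e \in A -> w e = 0.
    move=> eA; have /eqP : w e ^+ d = 0.
      by apply: (psumr_eq0P _ z0 eA) => u uA; rewrite exprn_ge0 ?w0.
    by rewrite expf_eq0 => /andP[_ /eqP].
  apply: le_trans RHS0; apply: sumr_le0 => e /andP[eA eB].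
  by rewrite !wz // mulr0 subr0 mulr0.
have zp : 0 < z.
  by rewrite lt_def zN0 sumr_ge0 // => u uA; rewrite exprn_ge0 ?w0.
have pE e : e \in A -> p e = w e ^+ d / z.
  by move=> eA; rewrite /p /choice_prob -/c zE (negbTE cN1) (negbTE zN0) eA dE.
(* The added terms, with [e] in [B] and [e != o], are nonnegative because [w e <= w o] and [c <= 1].
   Now only [o] itself is left out of the sum. *)
apply: (@le_trans _ _ (\sum_(e in A | e != o) p e * (w o - c * w e))).
  rewrite [leLHS]big_mkcond [leRHS]big_mkcond; apply: ler_sum => e _.
  have [eA|] //= := boolP (e \in A).
  have [eB|eB] /= := boolP (e \in B); last first.
    by have -> // : e != o by apply: contraNneq eB => ->.
  case: ifP => // _; rewrite mulr_ge0 // subr_ge0.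
  by rewrite (le_trans _ (wB _ eA eB)) // ler_piMl // w0.
rewrite (bigD1 o oA) /=.
set K := (1 - c) * _; set x := w o; have x0 : 0 <= x by exact: w0.
rewrite -(ler_pM2l zp) mulrCA mulrDr !mulr_sumr.
rewrite [z * (p o * _)]mulrA pE // [z * _]mulrCA mulfV // mulr1 -exprSr.
under eq_bigr => e /andP[eA _].
  rewrite mulrA pE // [z * _]mulrCA mulfV // mulr1; over.
under [X in _ <= _ * (_ + X)]eq_bigr => e /andP[eA _].
  rewrite mulrA pE // [z * _]mulrCA mulfV // mulr1 -exprSr; over.
set D := d.+1%:R : R in lo.
have D0 : 0 < D by rewrite ltr0n.
have Dd : d%:R = D - 1 by rewrite /D -natr1 addrK.
have mn : #|A|%:R <= n%:R :> R by rewrite ler_nat.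
have KE : K * (n%:R + 2) = (1 - c) * (n%:R + 1).
  by rewrite /K -mulrA; congr (_ * _); field; rewrite gt_eqF.
have KDE : K * D * (n%:R + 2) = (1 - c) * (n%:R + 1) * D by rewrite mulrAC KE.
(* Coefficient of [x^(d+1)]: the inequality [young_pow] leaves one copy for each of the [#|A| - 1]
   elements other than [o], and the term of [o] on the right absorbs them. *)
have KD1 : #|A|%:R - 1 <= K * D.
  rewrite -(ler_pM2r n2) KDE; have := ler_wpM2r (ler0n R n) lo.
  have := ler0n R n; nra.
(* Coefficient of [w e ^ d.+1]. It amounts to [(1 - c) * D <= n + 2], which [hi] gives; this is the
   origin of [n + 2]. *)
have KD2 : D - 1 - c * D <= K * D.
  by rewrite -(ler_pM2r n2) KDE; rewrite Dd in hi; nra.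
rewrite -(ler_pM2l D0) mulr_sumr.
apply: (@le_trans _ _ (\sum_(e in A | e != o)
                          (K * D * w e ^+ d.+1 + x ^+ d.+1))).
  apply: ler_sum => e /andP[eA _]; have we := w0 _ eA.
  have := young_pow d we x0; rewrite -/D Dd.
  have := ler_wpM2r (exprn_ge0 d.+1 we) KD2; rewrite !(exprSr (w e)).
  set P := w e ^+ d; set X := x ^+ d.+1; lra.
rewrite big_split /= -mulr_sumr sumr_const.
have -> : #|[pred e in A | e != o]| = #|A|.-1.
  by rewrite (cardsD1 o A) oA /=; apply: eq_card => e; rewrite !inE andbC.
rewrite -mulr_natr -subn1 natrB //.
have := ler_wpM2r (exprn_ge0 d.+1 x0) KD1.
set X := x ^+ d.+1; set Y := \sum_(_ | _) _; lra.
Qed.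

(** * Expectations and query counts of programs *)

(** Expectation of an arbitrary function of the output. It composes along [bind], so the loops can
    be treated by induction with the rest of the run as [h]. *)
Fixpoint expect (R : realType) (V : finType) (A : Type) (f : {set V} -> R)
    (m : prog R V A) (h : A -> R) : R :=
  match m with
  | Ret x => h x
  | Query Q m' => expect f (m' (f Q)) h
  | Sample p m' => \sum_(v : V) p v * expect f (m' v) h
  end.

Lemma expected_valueE (R : realType) (V : finType) (f : {set V} -> R)
    (m : prog R V {set V}) : expected_value f m = expect f m f.
Proof.
rewrite /expected_value; elim: m => [x|Q m IH|p m IH] /=; last 1 first.
- under [RHS]eq_bigr => v _ do rewrite -IH mulr_sumr.
  rewrite exchange_big; apply: eq_bigr => S _ /=.
  by rewrite mulr_suml; apply: eq_bigr => v _; rewrite mulrA.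
- rewrite (bigD1 x) //= eqxx mul1r big1 ?addr0 // => S xS.
  by rewrite eq_sym (negbTE xS) mul0r.
- exact: IH.
Qed.

Lemma expect_bind (R : realType) (V : finType) (A B : Type) (f : {set V} -> R)
    (m : prog R V A) (c : A -> prog R V B) (h : B -> R) :
  expect f (bind m c) h = expect f m (fun x => expect f (c x) h).
Proof.
elim: m => [x|Q m IH|p m IH] //=.
by apply: eq_bigr => v _; rewrite IH.
Qed.

Lemma expectZ (R : realType) (V : finType) (A : Type) (f : {set V} -> R)
    (m : prog R V A) (x : R) (h : A -> R) :
  expect f m (fun y => x * h y) = x * expect f m h.
Proof.
elim: m => [y|Q m IH|p m IH] //=.
by rewrite mulr_sumr; apply: eq_bigr => v _; rewrite IH mulrCA.
Qed.

(** Associativity of [bind] is stated on query counts because equality of the programs themselves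
    would call for functional extensionality. *)
Lemma num_queries_bindA (R : realType) (V : finType) (A B C : Type)
    (f : {set V} -> R) (m : prog R V A) (c : A -> prog R V B)
    (d : B -> prog R V C) :
  num_queries f (bind (bind m c) d)
  = num_queries f (bind m (fun x => bind (c x) d)).
Proof.
by elim: m => [x|Q m IH|p m IH] //=; [rewrite IH | apply: eq_bigr].
Qed.

(** Against a fixed [f] this phase is deterministic, so a single [w'] describes both its result and
    its cost. *)
Lemma query_marginalsP (R : realType) (V : finType) (f : {set V} -> R)
    (S : {set V}) (s : seq V) (w : V -> R) :
  exists w' : V -> R,
  [/\ forall v, v \in s -> w' v = marginal f v S,
      forall v, v \notin s -> w' v = w v,
      forall h : (V -> R) -> R,
        expect f (query_marginals S (f S) s w) h = h w'
    & forall (B : Type) (c : (V -> R) -> prog R V B),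
        num_queries f (bind (query_marginals S (f S) s w) c)
        = (size s + num_queries f (c w'))%N].
Proof.
elim: s w => [|u s IH] w /=; first by exists w; split.
have [w' [h1 h2 h3 h4]] :=
  IH (fun v => if v == u then f (u |: S) - f S else w v).
exists w'; split=> [v|v|h|B c]; rewrite ?inE ?h3 ?h4 //.
- have [vs _|vs] := boolP (v \in s); first exact: h1.
  by rewrite orbF => /eqP vu; rewrite h2 // vu eqxx.
- by rewrite negb_or => /andP[vu vs]; rewrite h2 // (negbTE vu).
Qed.

Lemma add_elementP (R : realType) (V : finType) (f : {set V} -> R) (g a : R)
    (r : {set V} -> (V -> R) -> V -> R) (Vi S : {set V}) :
  exists w : V -> R,
  [/\ forall v, v \in Vi :\: S -> w v = marginal f v S,
      forall h : {set V} -> R, expect f (add_element g a r Vi S) h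
        = \sum_e choice_prob g a r (Vi :\: S) w e * h (e |: S)
    & forall (B : Type) (c : {set V} -> prog R V B),
        num_queries f (bind (add_element g a r Vi S) c)
        = (#|Vi :\: S|.+1
           + \max_(e | choice_prob g a r (Vi :\: S) w e != 0%R)
               num_queries f (c (e |: S)))%N].
Proof.
have [w [h1 _ h3 h4]] := query_marginalsP f S (enum (Vi :\: S)) (fun=> 0).
exists w; split=> [v vA|h|B c] /=.
- by rewrite h1 // mem_enum.
- by rewrite expect_bind h3.
- by rewrite num_queries_bindA h4 -cardE.
Qed.

(** * Residual optimum and the potential *)

Lemma disjoint_setU1 (T : finType) (x : T) (A B : {set T}) :
  [disjoint x |: A & B] = (x \notin B) && [disjoint A & B].
Proof. by rewrite !disjoints_subset subUset sub1set inE. Qed.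

Section Algorithm.

Variables (R : realType) (V : finType) (k : nat) (Vp : 'I_k -> {set V}).
Variables (b : 'I_k -> nat) (f : {set V} -> R) (g a : R).
Variable r : {set V} -> (V -> R) -> V -> R.

Hypothesis Vp_part : is_partition Vp.
Hypothesis b_bounds : forall i, (1 <= b i <= #|Vp i|)%N.
Hypothesis f_mono : monotone f.
Hypothesis g_ratio : pm_ratio_admissible Vp b f g.
Hypothesis g_gt0 : 0 < g.
Hypothesis a_curv : pm_curvature_admissible Vp b f a.
Hypothesis r_max : max_rule r.

Implicit Types (S O : {set V}) (I : {set 'I_k}) (i j : 'I_k) (e : V).

Let nbar := (\max_(i < k) #|Vp i|)%N.
Let K := (g^-1 + a - 1) * (1 - (nbar%:R + 2)^-1).

Let ga01 : 0 <= g * (1 - a) <= 1.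
Proof.
have [/andP[a0 a1] _] := a_curv; have [/andP[_ g1] _] := g_ratio.
apply/andP; split; first by rewrite mulr_ge0 ?subr_ge0 // ltW.
by rewrite mulr_ile1 ?subr_ge0 ?lerBlDr ?lerDl // ltW.
Qed.

Lemma candidates_neq0 S i : (#|S :&: Vp i| < b i)%N -> Vp i :\: S != set0.
Proof.
move=> Sb; apply/eqP => AE; have /andP[_ bV] := b_bounds i.
have : (#|Vp i| <= #|S :&: Vp i|)%N.
  by rewrite subset_leq_card // subsetI subxx andbT -setD_eq0 AE.
by lia.
Qed.

Lemma marginal_ge0 e S : 0 <= marginal f e S.
Proof. by rewrite subr_ge0 f_mono // subsetUr. Qed.

Lemma card_addI S e i j : e \in Vp i -> e \notin S ->
  #|(e |: S) :&: Vp j| = (#|S :&: Vp j| + (j == i))%N.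
Proof.
move=> ei eS; have [_ dis _] := Vp_part.
have [->|ji] := eqVneq j i.
  rewrite (cardsD1 e) !inE eqxx ei /= addnC; congr (_ + _)%N.
  apply: eq_card => u; rewrite !inE.
  by have [->|] := eqVneq u e; rewrite ?(negbTE eS).
rewrite addn0; apply: eq_card => u; rewrite !inE.
have [->|] //= := eqVneq u e; have := disjointFl (dis _ _ ji) ei.
by move=> ->; rewrite !andbF.
Qed.

(* [O] is what is left of the optimal solution once the elements of [S] have
   been exchanged for some of its elements. *)
Definition residual S O : Prop :=
  [disjoint S & O] /\ forall i, (#|O :&: Vp i| + #|S :&: Vp i| <= b i)%N.

Definition potential S O : R := f (S :|: O) + K * f S.

(** Part [i] loses one element of [O] and gains one of [S], so its count is unchanged. The choice
    [o = e] covers a draw that hits [O]. *)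
Lemma residual_swap S O i e o : residual S O -> e \in Vp i -> e \notin S ->
  o \in O -> o \in Vp i -> (e = o \/ e \notin O) ->
  residual (e |: S) (O :\ o).
Proof.
move=> [dSO cO] ei eS oO oi eo; split.
  rewrite disjoint_setU1 !inE negb_and negbK; apply/andP; split.
    by case: eo => [->|->]; rewrite ?eqxx ?orbT.
  by apply: disjointWr dSO; rewrite subD1set.
move=> j; rewrite (card_addI j ei eS); have := cO j.
have -> : (O :\ o) :&: Vp j = (O :&: Vp j) :\ o by rewrite setIDAC.
rewrite (cardsD1 o (O :&: Vp j)) !inE oO /=.
by have [->|_] := eqVneq j i; rewrite ?oi; lia.
Qed.

Lemma residual_add S O i e : residual S O -> e \in Vp i -> e \notin S ->
  (#|S :&: Vp i| < b i)%N -> O :&: Vp i = set0 -> residual (e |: S) O.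
Proof.
move=> [dSO cO] ei eS Sb O0; split.
  rewrite disjoint_setU1 dSO andbT; apply/negP => eO.
  by have : e \in O :&: Vp i by [rewrite inE eO ei]; rewrite O0 inE.
move=> j; rewrite (card_addI j ei eS); have [->|_] := eqVneq j i.
  by rewrite O0 cards0 add0n addn1.
by rewrite addn0.
Qed.

(** Both sets on the left extend [T] by one element: the ratio bounds the gain of [o] from above,
    the curvature that of [e] from below, and [f T] cancels. *)
Lemma exchange_bound S O e o : residual S O -> e \notin S -> e \notin O ->
  o \in O ->
  f (S :|: O) - f ((e |: S) :|: (O :\ o))
    <= g^-1 * marginal f o S - (1 - a) * marginal f e S.
Proof.
move=> [dSO cO] eS eO oO; set T := S :|: (O :\ o).
have pmT : pm_pair Vp b S T.
  split=> [|j]; first exact: subsetUl.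
  apply: leq_trans (leq_trans (leq_addr _ _) (cO j)); apply: subset_leq_card.
  by apply: setSI; rewrite subDset; apply: setUS; apply: subD1set.
have oT : o \notin T by rewrite !inE eqxx /= orbF (disjointFl dSO oO).
have eT : e \notin T by rewrite !inE negb_or eS negb_and eO orbT.
have := (proj2 g_ratio) g_gt0 S T o pmT oT.
have := (proj2 a_curv) S T e pmT eT.
rewrite /marginal -/T.
have -> : o |: T = S :|: O by rewrite setUCA setD1K.
have -> : e |: T = (e |: S) :|: (O :\ o) by rewrite setUA.
lra.
Qed.

Lemma K_ge0 : 0 <= K.
Proof.
have n2 : 0 < nbar%:R + 2 :> R by rewrite ltr_wpDl.
have gi : g * g^-1 = 1 by rewrite mulfV // gt_eqF.
have /andP[_ c1] := ga01.
rewrite /K mulr_ge0 //.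
  by rewrite -(pmulr_rge0 _ g_gt0); lra.
by rewrite subr_ge0 invf_le1 // -lerBlDr (le_trans _ (ler0n _ nbar)) //; lra.
Qed.

(** The new residual set depends on the drawn [e], so [h] has to dominate the potential for every
    residual [O']; this form chains through the loops. *)
Lemma add_element_potential S O i (h : {set V} -> R) :
  residual S O -> (#|S :&: Vp i| < b i)%N ->
  (forall e O', e \in Vp i -> e \notin S -> residual (e |: S) O' ->
     potential (e |: S) O' <= h (e |: S)) ->
  potential S O <= expect f (add_element g a r (Vp i) S) h.
Proof.
move=> res Sb hle; have [w [wE -> _]] := add_elementP f g a r (Vp i) S.
set A := Vp i :\: S in wE *.
have w0 e : e \in A -> 0 <= w e by move=> eA; rewrite wE // marginal_ge0.
have A0 : A != set0. by exact: candidates_neq0.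
have [p0 p1 pA] := choice_prob_dist ga01 r_max A0 w0.
set p := choice_prob g a r A w in p0 p1 pA *.
have pN e : e \notin A -> p e = 0.
  by move=> eA; apply/eqP; apply: contraNT eA => /pA.
have sumA (F : V -> R) : \sum_e p e * F e = \sum_(e in A) p e * F e.
  rewrite [RHS]big_mkcond; apply: eq_bigr => e _.
  by case: ifPn => // /pN ->; rewrite mul0r.
have AP e : e \in A -> e \in Vp i /\ e \notin S by rewrite !inE => /andP[].
rewrite -[leLHS]mul1r -p1 mulr_suml !sumA.
have fw e : e \in A -> f (e |: S) = f S + w e.
  by move=> eA; rewrite wE // /marginal addrC subrK.
have K0 := K_ge0.
have [O0|[o1 o1O]] := set_0Vmem (O :&: Vp i).
  apply: ler_sum => e eA; rewrite ler_wpM2l // (le_trans _ (hle e O _ _ _)) //.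
  - rewrite /potential lerD ?ler_wpM2l // f_mono // ?subsetUr //.
    by rewrite setSU // subsetUr.
  - by case: (AP _ eA).
  - by case: (AP _ eA).
  - by case: (AP _ eA) => ? ?; apply: residual_add O0.
have [o oOV omax] := arg_maxP w o1O.
have /setIP[oO oi] := oOV.
have oS : o \notin S by rewrite (disjointFl (proj1 res) oO).
have oA : o \in A by rewrite inE oS.
have An : (#|A| <= nbar)%N.
  by apply: leq_trans (leq_bigmax i); rewrite subset_leq_card // subsetDl.
have wmax e : e \in A -> e \in O -> w e <= w o.
  by move=> /AP[ei _] eO; apply: omax; apply/setIP.
have key := choice_prob_exchange ga01 r_max w0 oA oO wmax An.
rewrite -/p in key.
(* [G e] bounds the loss of [f (S :|: O)]; it is zero for [e] in [O], since moving [e] into [S]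
   leaves the union unchanged. *)
pose G e := if e \in O then 0 else g^-1 * w o - (1 - a) * w e.
apply: (@le_trans _ _ (\sum_(e in A) p e * (potential S O + K * w e - G e))).
  rewrite -subr_ge0 -sumrB.
  under eq_bigr => e _ do
    rewrite -mulrBr addrAC [_ + K * _]addrC addrK mulrBr mulrCA.
  rewrite sumrB -mulr_sumr subr_ge0.
  rewrite (bigID (mem O)) /= big1 ?add0r; last first.
    by move=> e /andP[_ eO]; rewrite /G eO mulr0.
  rewrite -(ler_pM2l g_gt0) mulr_sumr.
  have gi : g * g^-1 = 1 by rewrite mulfV // gt_eqF.
  (* Here [g * (g^-1 + a - 1) = 1 - g * (1 - a)] turns [K] into the constant of
     [choice_prob_exchange]. *)
  have -> : g * (K * \sum_(e in A) p e * w e) =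
     (1 - g * (1 - a)) * (1 - (nbar%:R + 2)^-1) * \sum_(e in A) p e * w e.
    by rewrite /K !mulrA; congr (_ * _ * _); lra.
  apply: le_trans key; rewrite le_eqVlt; apply/orP; left; apply/eqP.
  apply: eq_bigr => e /andP[_ /negbTE eO]; rewrite /G eO mulrCA; congr (_ * _).
  by rewrite mulrBr !mulrA gi mul1r.
apply: ler_sum => e eA; rewrite ler_wpM2l //; have [ei eS] := AP e eA.
have [eO|eO] := boolP (e \in O).
  have re : residual (e |: S) (O :\ e).
    by apply: (residual_swap res ei eS eO ei); left.
  apply: le_trans (hle e _ ei eS re).
  rewrite /G eO subr0 /potential fw // [e |: S]setUC -setUA setD1K //.
  by rewrite mulrDr addrA lexx.
have ro : residual (e |: S) (O :\ o).
  by apply: (residual_swap res ei eS oO oi); right.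
apply: le_trans (hle e _ ei eS ro).
have := exchange_bound res eS eO oO.
rewrite /G (negbTE eO) /potential fw // -!wE // mulrDr; lra.
Qed.

(** * Loop invariants and termination *)

(** Weighted number of insertions still to come. Weight 1 measures the fuel needed; weight
    [#|Vp i| + 1] bounds the remaining queries. *)
Definition deficit (u : 'I_k -> nat) S : nat :=
  (\sum_i (b i - #|S :&: Vp i|) * u i)%N.

Lemma deficit_add u S i e : e \in Vp i -> e \notin S ->
  (#|S :&: Vp i| < b i)%N -> (deficit u (e |: S) + u i = deficit u S)%N.
Proof.
move=> ei eS Sb; rewrite /deficit (bigD1 i) //= [RHS](bigD1 i) //= addnAC.
congr (_ + _)%N.
  by rewrite (card_addI i ei eS) eqxx -mulSnr; congr (_ * _)%N; lia.
by apply: eq_bigr => j ji; rewrite (card_addI j ei eS) (negbTE ji) addn0.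
Qed.

Definition active I S : Prop := forall i, (i \in I) = (#|S :&: Vp i| < b i)%N.

Lemma active_add I S i e : active I S -> i \in I -> e \in Vp i -> e \notin S ->
  active (if (b i <= #|(e |: S) :&: Vp i|)%N then I :\ i else I) (e |: S).
Proof.
move=> act iI ei eS j; have := act j; rewrite (card_addI j ei eS).
have [->|ji] := eqVneq j i.
  rewrite iI (card_addI i ei eS) eqxx.
  by case: ifP; rewrite ?inE ?eqxx ?iI /=; lia.
by rewrite addn0 => <-; case: ifP; rewrite ?inE ?ji.
Qed.

(** The list is fixed when the pass starts while [I] shrinks, but only by the index just treated,
    which [uniq] keeps out of the rest of the list. The drop of the deficit by [size s] pays for the
    fuel. *)
Lemma for_loop_potential s I S O (h : {set 'I_k} * {set V} -> R) :
  uniq s -> {subset s <= I} -> active I S -> residual S O ->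
  (forall I' S' O', active I' S' -> residual S' O' ->
     (deficit (fun=> 1%N) S' + size s = deficit (fun=> 1%N) S)%N ->
     potential S' O' <= h (I', S')) ->
  potential S O <= expect f (for_loop Vp b g a r s I S) h.
Proof.
elim: s I S O => [|i s IH] I S O /=.
  by move=> _ _ act res; apply => //; rewrite addn0.
move=> /andP[is_ us] sI act res hle; rewrite expect_bind.
have iI : i \in I by rewrite sI // mem_head.
have Sb : (#|S :&: Vp i| < b i)%N by rewrite -act.
apply: (add_element_potential res Sb) => e O' ei eS res'.
apply: IH (active_add act iI ei eS) res' _ => // [j js|I' S' O'' act' res'' D].
  have jI : j \in I by rewrite sI // inE js orbT.
  case: ifP => // _; rewrite !inE jI andbT.
  by apply: contraNneq is_ => <-.
by apply: hle => //; rewrite -(deficit_add (fun=> 1%N) ei eS Sb) -D addnS addn1.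
Qed.

Lemma while_loop_potential n I S O :
  active I S -> residual S O -> (deficit (fun=> 1%N) S <= n)%N ->
  potential S O <= (K + 1) * expect f (while_loop Vp b g a r n I S) f.
Proof.
(* On exit every part is full, which forces the residual set to be empty. *)
have fin I0 S0 O0 : I0 = set0 -> active I0 S0 -> residual S0 O0 ->
    potential S0 O0 <= (K + 1) * f S0.
  move=> -> act [_ cO].
  suff -> : O0 = set0 by rewrite /potential setU0; lra.
  apply/setP => e; rewrite inE; apply/negP => eO.
  have [cov _ _] := Vp_part; have : e \in [set: V] by [].
  rewrite -cov => /bigcupP[i _ ei]; have := act i; have := cO i.
  rewrite inE (cardsD1 e (O0 :&: Vp i)) !inE eO ei /=; lia.
elim: n I S O => [|n IH] I S O act res D /=.
  have I0 : I = set0.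
    apply/setP => i; rewrite act inE; move: D; rewrite leqn0 sum_nat_eq0.
    by move=> /forallP/(_ i) /=; rewrite muln1; lia.
  by rewrite I0 eqxx; apply: (fin I).
case: eqVneq => [I0|I0] /=; first exact: (fin I).
rewrite expect_bind.
(* The factor moves inside so that the induction hypothesis bounds the continuation pointwise. *)
rewrite -expectZ.
apply: for_loop_potential act res _ => [||I' S' O' act' res' D'].
- exact: enum_uniq.
- by move=> i; rewrite mem_enum.
apply: IH => //; have : (0 < size (enum I))%N by rewrite -cardE card_gt0.
move: D; rewrite -D'; case: (size (enum I)) => // m D _.
by move: D; rewrite addnS ltnS; apply: leq_trans; apply: leq_addr.
Qed.

(** * Query count *)

Lemma for_loop_queries (B : Type) s I S
    (c : {set 'I_k} * {set V} -> prog R V B) :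
  let u i := #|Vp i|.+1 in
  uniq s -> {subset s <= I} -> active I S ->
  (forall I' S', active I' S' ->
     (num_queries f (c (I', S')) <= deficit u S')%N) ->
  (num_queries f (bind (for_loop Vp b g a r s I S) c) <= deficit u S)%N.
Proof.
move=> u; elim: s I S => [|i s IH] I S; first by move=> _ _ act; apply.
rewrite cons_uniq => /andP[is_ us] sI act hle.
rewrite -[for_loop _ _ _ _ _ _ _ _]/(bind (add_element g a r (Vp i) S) _).
rewrite num_queries_bindA.
have [w [wE _ ->]] := add_elementP f g a r (Vp i) S.
set A := Vp i :\: S in wE *.
have w0 e : e \in A -> 0 <= w e by move=> eA; rewrite wE // marginal_ge0.
have iI : i \in I by rewrite sI // mem_head.
have Sb : (#|S :&: Vp i| < b i)%N by rewrite -act.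
have [_ _ pA] := choice_prob_dist ga01 r_max (candidates_neq0 Sb) w0.
have uA : (#|A|.+1 <= u i)%N by rewrite ltnS subset_leq_card // subsetDl.
(* A candidate exists, so the deficit is at least [u i]. That share pays for the current insertion,
   and the remainder bounds the continuation after any draw. *)
have [e0 e0A] := set0Pn _ (candidates_neq0 Sb).
have uD : (u i <= deficit u S)%N.
  move: e0A; rewrite inE => /andP[e0S e0i].
  by rewrite -(deficit_add u e0i e0S Sb) leq_addl.
rewrite -(subnKC uD); apply: leq_add => //.
apply/bigmax_leqP => e /pA; rewrite inE => /andP[eS ei].
rewrite -(deficit_add u ei eS Sb) addnK.
apply: IH (active_add act iI ei eS) hle => // j js.
have jI : j \in I by rewrite sI // inE js orbT.
case: ifP => // _; rewrite !inE jI andbT.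
by apply: contraNneq is_ => <-.
Qed.

Lemma while_loop_queries n I S : active I S ->
  (num_queries f (while_loop Vp b g a r n I S)
    <= deficit (fun i => #|Vp i|.+1) S)%N.
Proof.
elim: n I S => [|n IH] I S act /=; case: ifP => // _.
apply: for_loop_queries act _ => [||I' S']; first exact: enum_uniq.
  by move=> i; rewrite mem_enum.
exact: IH.
Qed.

End Algorithm.

(** * The approximation guarantee and the query bound *)

Theorem theorem1 :
  exists C : nat,
  forall (R : realType) (V : finType) (k : nat) (Vp : 'I_k -> {set V})
    (b : 'I_k -> nat) (f : {set V} -> R) (gamma alpha gamma' alpha' : R)
    (r : {set V} -> (V -> R) -> V -> R) (Sstar : {set V}),
  is_partition Vp ->
  (forall i : 'I_k, (1 <= b i <= #|Vp i|)%N) ->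
  (forall S : {set V}, 0 <= f S) ->
  monotone f ->
  f set0 = 0 ->
  is_pm_ratio Vp b f gamma ->
  is_pm_curvature Vp b f alpha ->
  0 < gamma' <= gamma ->
  alpha <= alpha' <= 1 ->
  max_rule r ->
  is_optimal Vp b f Sstar ->
  let nbar := (\max_(i < k) #|Vp i|)%N in
  let P := Prob Vp b gamma' alpha' r in
  f Sstar <=
    ((gamma'^-1 + alpha' - 1) * (1 - (nbar%:R + 2)^-1) + 1)
      * expected_value f P
  /\ (num_queries f P <= C * \sum_(i < k) #|Vp i| * b i)%N.
Proof.
(* The constant 2 comes from [#|Vp i| + 1 <= 2 * #|Vp i|], as parts are nonempty. *)
exists 2 => R V k Vp b f gamma alpha g a r Sstar part bb _ mono f0.
move=> [[/andP[ga0 ga1] rat] _] [[/andP[al0 al1] cur] _] /andP[g0 gle].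
move=> /andP[ale a1] rmax [feas _] nbar P.
have gg : 0 < gamma by apply: lt_le_trans gle.
(* Since marginals are nonnegative, lowering the ratio, like raising the curvature below, preserves
   admissibility. *)
have g_ratio : pm_ratio_admissible Vp b f g.
  split=> [|_ S T e pm eT]; first by rewrite ltW //= (le_trans gle).
  apply: le_trans (rat gg _ _ _ pm eT) _.
  by rewrite ler_wpM2r ?(marginal_ge0 mono) // lef_pV2.
have a_curv : pm_curvature_admissible Vp b f a.
  split=> [|S T e pm eT]; first by rewrite a1 (le_trans al0).
  apply: le_trans (cur _ _ _ pm eT).
  by rewrite ler_wpM2r ?(marginal_ge0 mono) // lerD2l lerN2.
have act : active Vp b [set: 'I_k] set0.
  by move=> i; rewrite inE set0I cards0; case/andP: (bb i).
have defE u : deficit Vp b u set0 = (\sum_i b i * u i)%N.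
  by apply: eq_bigr => i _; rewrite set0I cards0 subn0.
split; last first.
  apply: leq_trans
    (while_loop_queries part bb mono g_ratio g0 a_curv rmax _ act) _.
  rewrite defE big_distrr /=; apply: leq_sum => i _.
  by have := bb i; nia.
have res : residual Vp b set0 Sstar.
  split=> [|i]; first by rewrite disjoints_subset sub0set.
  by rewrite set0I cards0 addn0 feas.
have := while_loop_potential part bb mono g_ratio g0 a_curv rmax act res.
rewrite defE => /(_ (\sum_i b i)%N).
rewrite /potential set0U f0 mulr0 addr0 expected_valueE; apply.
by under eq_bigr do rewrite muln1.
Qed.
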